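(* Let $A$ be a commutative continuous inverse algebra (CIA), $G$ a compact group and $(A,G,\alpha)$ a free dynamical system. Then the induced action $$\sigma:\Gamma_A\times G\to\Gamma_A,\qquad(\chi,g)\mapsto\chi\circ\alpha(g)$$ is continuous and we obtain a topological principal bundle $(\Gamma_A,\Gamma_A/G,G,\sigma,\mathrm{pr})$, where $\mathrm{pr}:\Gamma_A\to\Gamma_A/G$ is the orbit map.
   Context: Algebras are complex. A dynamical system $(A,G,\alpha)$ consists of a unital locally convex algebra $A$, a topological group $G$ and a group homomorphism $\alpha:G\to\mathrm{Aut}(A)$ such that the action map $G\times A\to A$ is continuous. $\Gamma_A:=\mathrm{Hom}_{\mathrm{alg}}(A,\mathbb{C})\setminus\{0\}$ is the spectrum of $A$, with the topology of pointwise convergence on $A$. A unital locally convex algebra $A$ is a continuous inverse algebra (CIA) if its group of units $A^{\times}$ is open in $A$ and the inversion $A^{\times}\to A^{\times}$, $a\mapsto a^{-1}$ is continuous at $1_A$. A family $(\pi_j,V_j)_{j\in J}$ of (continuous) representations of $G$ is point separating if for each $g\neq 1_G$ there is $j\in J$ with $\pi_j(g)\neq\mathrm{id}_{V_j}$. For a representation $(\pi,V)$ of $G$ put $$\Gamma_A V:=(A\otimes V)^G=\{s\in A\otimes V:\ (\alpha(g)\otimes\pi(g))(s)=s\ \text{for all } g\in G\}.$$ A dynamical system $(A,G,\alpha)$ with $A$ commutative is called free if there exists a point separating family $(\pi_j,V_j)_{j\in J}$ of representations of $G$ such that for all $j\in J$ and all $\chi\in\Gamma_A$ the map $\Gamma_A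 V_j\to V_j$, $a\otimes v\mapsto\chi(a)\cdot v$ (the restriction of $\chi\otimes\mathrm{id}_{V_j}$) is surjective. A topological principal bundle is a Hausdorff space $X$ with a free and proper continuous right action of a topological group $G$ such that each orbit of the action is homeomorphic to $G$ and the orbit space $X/G$ is Hausdorff (local triviality is not required); it is denoted $(X,X/G,G,\sigma,\mathrm{pr})$. *)

(* Defs.v *)
From HB Require Import structures.
From mathcomp Require Import all_boot all_order all_algebra.
From mathcomp Require Import monoid generic_quotient complex.
From mathcomp Require Import boolp classical_sets functions reals.
From mathcomp Require Import topology tvs.

Set Implicit Arguments.
Unset Strict Implicit.
Unset Printing Implicit Defensive.

Import GRing.Theory Num.Theory.

Local Open Scope classical_set_scope.
Local Open Scope ring_scope.

(* Algebraic tensor product of two modules: finite formal sums of pairs, i.e.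
   elements of seq (U * V), modulo the congruence generated by bilinearity.
   The relation uses no formal negatives: - (u, v) is (- u, v). *)
Section Tensor.
Variables (K : comPzRingType) (U V : lmodType K).

Inductive tens_congr : seq (U * V) -> seq (U * V) -> Prop :=
| tens_refl s : tens_congr s s
| tens_sym s t : tens_congr s t -> tens_congr t s
| tens_trans s t r : tens_congr s t -> tens_congr t r -> tens_congr s r
| tens_cat s s' t t' :
    tens_congr s s' -> tens_congr t t' -> tens_congr (s ++ t) (s' ++ t')
| tens_comm s t : tens_congr (s ++ t) (t ++ s)
| tens_addl u u' v : tens_congr [:: (u + u', v)] [:: (u, v); (u', v)]
| tens_addr u v v' : tens_congr [:: (u, v + v')] [:: (u, v); (u, v')]
| tens_scale a u v : tens_congr [:: (a *: u, v)] [:: (u, a *: v)]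
| tens_zero v : tens_congr [:: (0, v)] [::].

Definition tens_eqb (s t : seq (U * V)) : bool := `[< tens_congr s t >].

Lemma tens_eqb_refl : reflexive tens_eqb.
Proof. by move=> s; apply/asboolP; apply: tens_refl. Qed.

Lemma tens_eqb_sym : symmetric tens_eqb.
Proof. by move=> s t; apply/asboolP/asboolP; apply: tens_sym. Qed.

Lemma tens_eqb_trans : transitive tens_eqb.
Proof.
by move=> s t r /asboolP ts /asboolP sr; apply/asboolP; apply: tens_trans sr.
Qed.

Canonical tens_equiv :=
  EquivRel tens_eqb tens_eqb_refl tens_eqb_sym tens_eqb_trans.

Definition tensor := {eq_quot tens_equiv}%qT.
HB.instance Definition _ := Choice.on tensor.
HB.instance Definition _ := Quotient.on tensor.

Definition tens_pi (s : seq (U * V)) : tensor := (\pi_tensor s)%qT.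

Lemma tens_piP s t : tens_pi s = tens_pi t <-> tens_congr s t.
Proof.
split=> [/eqquotP/asboolP//|st]; apply/eqquotP; exact/asboolP.
Qed.

Lemma tens_reprK (x : tensor) : tens_pi (repr x) = x.
Proof. exact: reprK. Qed.

Lemma tens_congr_repr s : tens_congr (repr (tens_pi s)) s.
Proof. by apply/tens_piP; rewrite tens_reprK. Qed.

Definition tens_add (x y : tensor) : tensor := tens_pi (repr x ++ repr y).

Definition tens_scal (a : K) (x : tensor) : tensor :=
  tens_pi [seq (a *: p.1, p.2) | p <- repr x].

Lemma tens_congr_map a s t : tens_congr s t ->
  tens_congr [seq (a *: p.1, p.2) | p <- s] [seq (a *: p.1, p.2) | p <- t].
Proof.
elim=> {s t} /=.
- by move=> s; exact: tens_refl.
- by move=> s t _; exact: tens_sym.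
- by move=> s t r _ st _; exact: tens_trans.
- by move=> s s' t t' _ ss' _ tt'; rewrite !map_cat; exact: tens_cat.
- by move=> s t; rewrite !map_cat; exact: tens_comm.
- by move=> u u' v; rewrite scalerDr; exact: tens_addl.
- by move=> u v v'; exact: tens_addr.
- by move=> b u v; rewrite scalerA mulrC -scalerA; exact: tens_scale.
- by move=> v; rewrite scaler0; exact: tens_zero.
Qed.

Lemma tens_piD s t : tens_add (tens_pi s) (tens_pi t) = tens_pi (s ++ t).
Proof. by apply/tens_piP; apply: tens_cat; exact: tens_congr_repr. Qed.

Lemma tens_piZ a s :
  tens_scal a (tens_pi s) = tens_pi [seq (a *: p.1, p.2) | p <- s].
Proof. by apply/tens_piP; apply: tens_congr_map; exact: tens_congr_repr. Qed.

Lemma tens_addA : associative tens_add.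
Proof.
move=> x y z; rewrite -[x]tens_reprK -[y]tens_reprK -[z]tens_reprK.
by rewrite !tens_piD catA.
Qed.

Lemma tens_addC : commutative tens_add.
Proof. by move=> x y; apply/tens_piP; exact: tens_comm. Qed.

Lemma tens_add0 : left_id (tens_pi [::]) tens_add.
Proof. by move=> x; rewrite -[x]tens_reprK tens_piD. Qed.

Lemma tens_scalDl x a b :
  tens_scal (a + b) x = tens_add (tens_scal a x) (tens_scal b x).
Proof.
rewrite -[x]tens_reprK !tens_piZ tens_piD; apply/tens_piP.
elim: (repr x) => [|[u v] s IH] /=; first exact: tens_refl.
set f := [seq _ | p <- s] in IH *; set g := [seq _ | p <- s] in IH *.
set h := [seq _ | p <- s] in IH *.
apply: (@tens_trans _ ([:: (a *: u, v); (b *: u, v)] ++ (g ++ h))).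
  rewrite -[(_, v) :: f]/([:: _] ++ f); apply: tens_cat => //.
  by rewrite scalerDl; exact: tens_addl.
rewrite -[X in tens_congr X]/([:: (a *: u, v)] ++ (([:: (b *: u, v)] ++ g) ++ h)).
rewrite -[X in tens_congr _ X]/([:: (a *: u, v)] ++ (g ++ ([:: (b *: u, v)] ++ h))).
apply: tens_cat; first exact: tens_refl.
rewrite [X in tens_congr _ X]catA; apply: tens_cat; last exact: tens_refl.
exact: tens_comm.
Qed.

Lemma tens_scal0 x : tens_scal 0 x = tens_pi [::].
Proof.
rewrite -[x]tens_reprK tens_piZ; apply/tens_piP.
elim: (repr x) => [|[u v] s IH] /=; first exact: tens_refl.
rewrite -[X in tens_congr X]/([:: _] ++ _) -[X in tens_congr _ X]cat0s.
by apply: tens_cat => //; rewrite scale0r; exact: tens_zero.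
Qed.

Lemma tens_scal1 : left_id 1 tens_scal.
Proof.
move=> x; rewrite -[x]tens_reprK tens_piZ; congr tens_pi.
by rewrite -[RHS]map_id; apply: eq_map => -[u v]; rewrite scale1r.
Qed.

Lemma tens_scalA a b x : tens_scal a (tens_scal b x) = tens_scal (a * b) x.
Proof.
rewrite -[x]tens_reprK !tens_piZ -map_comp; congr tens_pi.
by apply: eq_map => -[u v]; rewrite /= scalerA.
Qed.

Lemma tens_scalDr : right_distributive tens_scal tens_add.
Proof.
move=> a x y; rewrite -[x]tens_reprK -[y]tens_reprK.
by rewrite !(tens_piD, tens_piZ) map_cat.
Qed.

Lemma tens_addN : left_inverse (tens_pi [::]) (tens_scal (-1)) tens_add.
Proof.
by move=> x; rewrite -{2}[x]tens_scal1 -tens_scalDl addNr tens_scal0.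
Qed.

HB.instance Definition _ :=
  GRing.isZmodule.Build tensor tens_addA tens_addC tens_add0 tens_addN.

HB.instance Definition _ :=
  GRing.Zmodule_isLmodule.Build K tensor
    tens_scalA tens_scal1 tens_scalDr (fun x a b => tens_scalDl x a b).

Definition tens (u : U) (v : V) : tensor := tens_pi [:: (u, v)].

Lemma tensDl u u' v : tens (u + u') v = tens u v + tens u' v.
Proof. by rewrite [RHS]tens_piD; apply/tens_piP; exact: tens_addl. Qed.

Lemma tensDr u v v' : tens u (v + v') = tens u v + tens u v'.
Proof. by rewrite [RHS]tens_piD; apply/tens_piP; exact: tens_addr. Qed.

Lemma tensZl a u v : tens (a *: u) v = a *: tens u v.
Proof. by rewrite [RHS]tens_piZ. Qed.

Lemma tensZr a u v : tens u (a *: v) = a *: tens u v.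
Proof. by rewrite -tensZl; apply/tens_piP/tens_sym; exact: tens_scale. Qed.

Lemma tens_piE s : tens_pi s = \sum_(p <- s) tens p.1 p.2.
Proof.
elim: s => [|[u v] s IH]; first by rewrite big_nil.
by rewrite big_cons -IH [RHS]tens_piD.
Qed.

Lemma tensE (x : tensor) : x = \sum_(p <- repr x) tens p.1 p.2.
Proof. by rewrite -tens_piE tens_reprK. Qed.

End Tensor.

(* The linear map U (x) V -> W induced by a bilinear map b; only meaningful
   for b bilinear, see tens_lift_tens, tens_lift_linear and tens_lift_uniq. *)
Section TensorLift.
Variables (K : comPzRingType) (U V W : lmodType K) (b : U -> V -> W).

Definition tens_lift (x : tensor U V) : W := \sum_(p <- repr x) b p.1 p.2.

Hypothesis b_linl : forall v, linear (b^~ v).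
Hypothesis b_linr : forall u, linear (b u).

Lemma tens_lift_pi s : tens_lift (tens_pi s) = \sum_(p <- s) b p.1 p.2.
Proof.
have bDl u u' v : b (u + u') v = b u v + b u' v.
  by have := b_linl v 1 u u'; rewrite !scale1r.
have bDr u v v' : b u (v + v') = b u v + b u v'.
  by have := b_linr u 1 v v'; rewrite !scale1r.
have b0l v : b 0 v = 0 by apply: (addrI (b 0 v)); rewrite -bDl !addr0.
have b0r u : b u 0 = 0 by apply: (addrI (b u 0)); rewrite -bDr !addr0.
have bZl a u v : b (a *: u) v = a *: b u v.
  by have := b_linl v a u 0; rewrite b0l !addr0.
have bZr a u v : b u (a *: v) = a *: b u v.
  by have := b_linr u a v 0; rewrite b0r !addr0.
suff sumE r t : tens_congr r t ->
    \sum_(p <- r) b p.1 p.2 = \sum_(p <- t) b p.1 p.2.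
  exact/sumE/tens_congr_repr.
elim=> {s r t} //=.
- by move=> s t r _ -> _ ->.
- by move=> s s' t t' _ ss' _ tt'; rewrite !big_cat ss' tt'.
- by move=> s t; rewrite !big_cat /= addrC.
- by move=> u u' v; rewrite !big_cons !big_nil !addr0 bDl.
- by move=> u v v'; rewrite !big_cons !big_nil !addr0 bDr.
- by move=> a u v; rewrite !big_cons !big_nil !addr0 /= bZl bZr.
- by move=> v; rewrite big_cons !big_nil addr0 b0l.
Qed.

Lemma tens_lift_tens u v : tens_lift (tens u v) = b u v.
Proof. by rewrite tens_lift_pi big_seq1. Qed.

Lemma tens_lift_linear : linear tens_lift.
Proof.
move=> a x y; have bZl u v : b (a *: u) v = a *: b u v.
  have b0 : b 0 v = 0.
    by have := b_linl v (-1) 0 0; rewrite scaler0 addr0 scaleN1r addNr.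
  by have := b_linl v a u 0; rewrite b0 !addr0.
rewrite -[x]tens_reprK -[y]tens_reprK.
have -> : a *: tens_pi (repr x) + tens_pi (repr y) =
  tens_pi ([seq (a *: p.1, p.2) | p <- repr x] ++ repr y).
  by rewrite -tens_piD -tens_piZ.
rewrite !tens_lift_pi big_cat big_map scaler_sumr; congr (_ + _).
by apply: eq_bigr => p _; rewrite bZl.
Qed.

Lemma tens_lift_uniq (f : {linear tensor U V -> W}) :
  (forall u v, f (tens u v) = b u v) -> f =1 tens_lift.
Proof.
move=> fb x; rewrite {1}[x]tensE linear_sum /tens_lift.
by apply: eq_bigr => p _; exact: fb.
Qed.

End TensorLift.

Definition tens_map (K : comPzRingType) (U V U' V' : lmodType K)
    (f : {linear U -> U'}) (g : {linear V -> V'}) : tensor U V -> tensor U' V' :=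
  tens_lift (fun u v => tens (f u) (g v)).

Lemma tens_map_tens (K : comPzRingType) (U V U' V' : lmodType K)
    (f : {linear U -> U'}) (g : {linear V -> V'}) u v :
  tens_map f g (tens u v) = tens (f u) (g v).
Proof.
rewrite /tens_map tens_lift_tens // => [w|w] a x y.
- by rewrite linearP tensDl tensZl.
- by rewrite linearP tensDr tensZr.
Qed.

HB.mixin Record isTopologicalGroup G & Topological G & Group G := {
  mulg_continuous : continuous (fun p : G * G => (p.1 * p.2)%g);
  invg_continuous : continuous (fun g : G => (g^-1)%g)
}.

#[short(type="topologicalGroupType")]
HB.structure Definition TopologicalGroup :=
  {G of Topological G & Group G & isTopologicalGroup G}.

(* tvsType is the library's type of locally convex spaces. *)
HB.mixin Record isLocallyConvexAlgebra (K : numFieldType) A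
    & Tvs K A & GRing.Algebra K A := {
  mul_continuous : continuous (fun p : A * A => p.1 * p.2)
}.

#[short(type="lcAlgType")]
HB.structure Definition LocallyConvexAlgebra (K : numFieldType) :=
  {A of Tvs K A & GRing.Algebra K A & isLocallyConvexAlgebra K A}.

(* The unitRingType structure is no restriction: classically, it exists and its
   units and inverses are uniquely determined by the ring. As the set of units
   is open, continuity at 1 of the total inverse (which is the identity outside
   the units) is continuity at 1 of the inversion on the group of units. *)
HB.mixin Record isContinuousInverse (K : numFieldType) A
    & LocallyConvexAlgebra K A & GRing.UnitAlgebra K A := {
  unit_open : open [set a : A | a \is a GRing.unit];
  inv_continuous1 : {for (1 : A), continuous (fun a : A => a^-1)}
}.

#[short(type="ciaType")]
HB.structure Definition ContinuousInverseAlgebra (K : numFieldType) :=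
  {A of LocallyConvexAlgebra K A & GRing.UnitAlgebra K A
      & isContinuousInverse K A}.

#[short(type="comCiaType")]
HB.structure Definition ComContinuousInverseAlgebra (K : numFieldType) :=
  {A of ContinuousInverseAlgebra K A & GRing.ComNzRing A}.

(* The joint continuity makes every ds_act g a homeomorphism of A. *)
Record dynamical_system (K : numFieldType) (A : lcAlgType K)
    (G : topologicalGroupType) := DynamicalSystem {
  ds_act :> G -> {lrmorphism A -> A};
  ds_bij : forall g, bijective (ds_act g);
  ds_mul : forall g h, ds_act (g * h)%g =1 ds_act g \o ds_act h;
  ds_continuous : continuous (fun p : G * A => ds_act p.1 p.2)
}.

Record representation (K : numFieldType) (G : topologicalGroupType)
    (V : topologicalLmodType K) := Representation {
  rep_act :> G -> {linear V -> V};
  rep_bij : forall g, bijective (rep_act g);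
  rep_mul : forall g h, rep_act (g * h)%g =1 rep_act g \o rep_act h;
  rep_continuous : continuous (fun p : G * V => rep_act p.1 p.2)
}.

Definition point_separating (K : numFieldType) (G : topologicalGroupType)
    (J : Type) (V : J -> topologicalLmodType K)
    (pi : forall j, representation G (V j)) : Prop :=
  forall g : G, g <> 1%g -> exists j, ~ (pi j g =1 id).

(* Characters are not assumed continuous. As a type, spectrum A carries the
   subspace topology of the topology of pointwise convergence. *)
Definition spectrum (K : numFieldType) (A : lcAlgType K) : set {ptws A -> K^o} :=
  [set chi | [/\ linear (chi : A -> K^o),
                 forall a b : A, chi (a * b) = chi a * chi b
               & exists a : A, chi a <> 0]].
Arguments spectrum {K} A _.

Section Free.
Variables (K : numFieldType) (A : lcAlgType K) (G : topologicalGroupType).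
Variable alpha : dynamical_system A G.

Definition invariant_tensors (V : topologicalLmodType K)
    (pi : representation G V) : set (tensor A V) :=
  [set s | forall g : G, tens_map (alpha g) (pi g) s = s].

Definition tens_eval (chi : spectrum A) (V : lmodType K) : tensor A V -> V :=
  tens_lift (fun a v => (val chi a : K) *: v).

Lemma tens_eval_tens (chi : spectrum A) (V : lmodType K) (a : A) (v : V) :
  tens_eval chi (tens a v) = (val chi a : K) *: v.
Proof.
have [chi_lin _ _] := set_mem (valP chi).
rewrite /tens_eval tens_lift_tens // => [w|w] c x y.
- by rewrite chi_lin scalerDl scalerA.
- by rewrite scalerDr !scalerA mulrC.
Qed.

Definition free_system : Prop :=
  exists (J : Type) (V : J -> topologicalLmodType K)
         (pi : forall j, representation G (V j)),
    point_separating pi /\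
    forall (j : J) (chi : spectrum A),
      set_surj (invariant_tensors (pi j)) [set: V j] (@tens_eval chi (V j)).

End Free.

Record right_action (X : topologicalType) (G : topologicalGroupType) :=
  RightAction {
    ract :> X -> G -> X;
    ract1 : forall x, ract x 1%g = x;
    ractM : forall x g h, ract x (g * h)%g = ract (ract x g) h
  }.

Section PrincipalBundle.

Definition homeomorphic (X Y : topologicalType) : Prop :=
  exists (f : X -> Y) (h : Y -> X),
    [/\ cancel f h, cancel h f, continuous f & continuous h].

Definition proper_map (X Y : topologicalType) (f : X -> Y) : Prop :=
  [/\ continuous f,
      forall F : set X, closed F -> closed (f @` F)
    & forall L : set Y, compact L -> compact (f @^-1` L)].

Variables (X : topologicalType) (G : topologicalGroupType).
Variable sigma : right_action X G.

Definition orbit_set (x : X) : set X := range (sigma x).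

Definition orbit_eqb (x y : X) : bool := `[< orbit_set x y >].

Lemma orbit_eqb_refl : reflexive orbit_eqb.
Proof. by move=> x; apply/asboolP; exists 1%g => //; exact: ract1. Qed.

Lemma orbit_eqb_sym : symmetric orbit_eqb.
Proof.
by move=> x y; apply/asboolP/asboolP => -[g _ <-]; exists (g^-1)%g => //;
  rewrite -ractM mulgV ract1.
Qed.

Lemma orbit_eqb_trans : transitive orbit_eqb.
Proof.
move=> y x z /asboolP[g _ <-] /asboolP[h _ <-]; apply/asboolP.
by exists (g * h)%g => //; exact: ractM.
Qed.

Canonical orbit_equiv :=
  EquivRel orbit_eqb orbit_eqb_refl orbit_eqb_sym orbit_eqb_trans.

Definition orbit_space : topologicalType :=
  quotient_topology {eq_quot orbit_equiv}%qT.

(* The base is always X/G, and the projection the quotient map X -> X/G, so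
   that both are determined by sigma. *)
Record topological_principal_bundle : Prop := {
  tpb_hausdorff : hausdorff_space X;
  tpb_continuous : continuous (fun p : X * G => sigma p.1 p.2);
  tpb_free : forall x g, sigma x g = x -> g = 1%g;
  tpb_proper : proper_map (fun p : X * G => (p.1, sigma p.1 p.2));
  tpb_orbit : forall x, homeomorphic (orbit_set x) G;
  tpb_base_hausdorff : hausdorff_space orbit_space
}.

End PrincipalBundle.

Section SpectrumAction.
Variables (K : numFieldType) (A : lcAlgType K) (G : topologicalGroupType).
Variable alpha : dynamical_system A G.

Lemma spectrum_comp (chi : spectrum A) (g : G) :
  spectrum A ((val chi : A -> K^o) \o alpha g).
Proof.
have [chi_lin chi_mul [a chia]] := set_mem (valP chi).
have [f fK Kf] := ds_bij alpha g.
split=> [c x y|x y|] /=.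
- by rewrite linearP chi_lin.
- by rewrite rmorphM chi_mul.
- by exists (f a); rewrite Kf.
Qed.

Definition spectrum_act (chi : spectrum A) (g : G) : spectrum A :=
  exist (fun f => f \in spectrum A) _ (mem_set (spectrum_comp chi g)).

Lemma spectrum_act1 chi : spectrum_act chi 1%g = chi.
Proof.
apply: val_inj; apply/funext => a /=; congr (val chi _).
have [f fK Kf] := ds_bij alpha 1%g.
by apply: (can_inj fK); rewrite -[LHS](ds_mul alpha) mulg1.
Qed.

Lemma spectrum_actM chi g h :
  spectrum_act chi (g * h)%g = spectrum_act (spectrum_act chi g) h.
Proof.
by apply: val_inj; apply/funext => a /=; congr (val chi _); exact: ds_mul.
Qed.

Definition spectrum_action : right_action (spectrum A) G :=
  RightAction spectrum_act1 spectrum_actM.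

End SpectrumAction.

(* Main.v *)
Require Import Defs.
From mathcomp Require Import all_boot all_order all_algebra complex.
From mathcomp Require Import boolp functions classical_sets.
From mathcomp Require Import reals topology normedtype.

Set Implicit Arguments.
Unset Strict Implicit.
Unset Printing Implicit Defensive.

Import Order.TTheory GRing.Theory Num.Theory.

Local Open Scope classical_set_scope.
Local Open Scope ring_scope.

(** The statement splits into general topology and a little spectral theory.

    Topology.  For a compact group [G] acting continuously and freely on a
    Hausdorff space [X], everything required of a principal bundle is formal
    ([compact_free_action_bundle]).  The single tool is that projecting away a
    compact factor is a closed map ([closed_proj_compact]).  It makes the shear
    map [(x, g) |-> (x, x g)] closed, because the image of [F] is the projection
    along [G] of the closed set of all [((x, y), g)] with [x g = y] and
    [(x, g)] in [F].  In particular the orbit relation, the image of the whole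
    space, is closed, and since the orbit projection is open, [X/G] is
    Hausdorff.  The same tool shows that a map into a compact space with closed
    graph is continuous, and the inverse [x g |-> g] of an orbit map has closed
    graph.

    Spectrum.  A character vanishes on no unit, so if [1 - c u] is a unit for
    all small scalars [c], then [chi u] cannot be large: the choice
    [c = 1 / chi u] would put the unit [1 - c u] in the kernel of [chi].  As the
    units form a neighbourhood of [1], this bounds all characters at once near
    [0] ([spectrum_bounded_near0]), and they are therefore equicontinuous.
    Writing
    [chi (alpha g a) - psi (alpha h a)
       = (chi - psi) (alpha g a) + psi (alpha g a - alpha h a)],
    the first term is small by pointwise convergence and the second by
    equicontinuity, so the action on the spectrum is jointly continuous.

    Freeness.  If [s] is invariant under [alpha g (x) pi g], applying
    [chi (x) id] to [s = (alpha g (x) pi g) s] gives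
    [(chi (x) id) s = pi g ((chi o alpha g (x) id) s)] ([tens_eval_invariant]).
    When [g] fixes [chi], this says that [pi g] fixes every value of
    [chi (x) id] on invariant tensors.  By surjectivity [pi g] is the identity,
    for every member of a point separating family, so [g = 1]. *)

(** * Closed maps and closed graphs *)

Section Topology.
Context {X Y : topologicalType}.

Lemma injective_hausdorff (f : X -> Y) :
  continuous f -> injective f -> hausdorff_space Y -> hausdorff_space X.
Proof.
move=> cf injf hY p q pq; apply/injf/hY => U V fpU fqV.
by have [x [Ux Vx]] := pq _ _ (cf _ _ fpU) (cf _ _ fqV); exists (f x).
Qed.

Lemma hausdorff_prod :
  hausdorff_space X -> hausdorff_space Y -> hausdorff_space (X * Y)%type.
Proof.
move=> hX hY [a b] [a' b'] cl; congr (_, _).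
  apply: hX => U V aU a'V.
  by have [[x y] [/= Ux Vx]] := cl _ _ (cvg_fst aU) (cvg_fst a'V); exists x.
apply: hY => U V bU b'V.
by have [[x y] [/= Uy Vy]] := cl _ _ (cvg_snd bU) (cvg_snd b'V); exists y.
Qed.

Lemma closed_coincidence (f g : X -> Y) :
  continuous f -> continuous g -> hausdorff_space Y ->
  closed [set x | f x = g x].
Proof.
move=> cf cg hY x clx; apply: hY => U V fxU gxV.
have nUV : nbhs x (f @^-1` U `&` g @^-1` V).
  by apply: filterI; [exact: cf|exact: cg].
have [y [/= fgy [Uy Vy]]] := clx _ nUV.
by exists (f y); split; rewrite // fgy.
Qed.

(** The tube lemma: if the fibre over [x] misses [C], compactness gives one
    neighbourhood of [x] all of whose fibres miss [C]. *)
Lemma closed_proj_compact (C : set (X * Y)) :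
  compact [set: Y] -> closed C -> closed (fst @` C).
Proof.
move=> /compact_near_coveringP cY cC; rewrite -openC openE => x nCx.
have /cY : forall y, [set: Y] y ->
    \forall y' \near y & x' \near nbhs x, ~ C (x', y').
  move=> y _; have : nbhs (x, y) (~` C).
    apply: open_nbhs_nbhs; split; first exact: closed_openC.
    by move=> Cxy; apply: nCx; exists (x, y).
  by case=> -[U V] /= [xU yV] UVC; exists (V, U) => //= -[b a] /= [Vb Ua];
     exact: (UVC (a, b)).
apply: filterS => x' x'C [[a y] Cy /= eqx]; rewrite -eqx in x'C.
exact: x'C Cy.
Qed.

(** The preimage of [F] is the projection of the part of the graph over [F]. *)
Lemma closed_graph_continuous (f : X -> Y) :
  compact [set: Y] -> closed [set p : X * Y | f p.1 = p.2] -> continuous f.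
Proof.
move=> cY cf; apply/continuous_closedP => F cF.
have -> : f @^-1` F = fst @` ([set p | f p.1 = p.2] `&` snd @^-1` F).
  apply/seteqP; split=> [x Fx|_ [[x y] [/= fxy Fy] <-]].
    by exists (x, f x).
  by rewrite /preimage /= fxy.
apply: closed_proj_compact => //; apply: closedI => //.
by apply: preimage_closed => // p _; exact: cvg_snd.
Qed.

End Topology.

(** * Free actions of compact groups *)

Section CompactGroupAction.
Context {X : topologicalType} {G : topologicalGroupType}.
Variable sigma : right_action X G.
Hypothesis hX : hausdorff_space X.
Hypothesis cG : compact [set: G].
Hypothesis csigma : continuous (fun p : X * G => sigma p.1 p.2).

Lemma ractKV x g : sigma (sigma x g) g^-1%g = x.
Proof. by rewrite -ractM mulgV ract1. Qed.

Lemma ract_continuous g : continuous (sigma^~ g).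
Proof.
move=> x; apply: (@continuous_comp _ _ _ (fun x => (x, g))
  (fun p : X * G => sigma p.1 p.2)); last exact: csigma.
by apply: cvg_pair; [exact: cvg_id|exact: cvg_cst].
Qed.

Lemma orbit_map_continuous x : continuous (sigma x).
Proof.
move=> g; apply: (@continuous_comp _ _ _ (fun g => (x, g))
  (fun p : X * G => sigma p.1 p.2)); last exact: csigma.
by apply: cvg_pair; [exact: cvg_cst|exact: cvg_id].
Qed.

Lemma shear_continuous : continuous (fun p : X * G => (p.1, sigma p.1 p.2)).
Proof. by move=> p; apply: cvg_pair; [exact: cvg_fst|exact: csigma]. Qed.

(** The image of [F] is the projection along the compact group of the closed
    set [C] of triples [((x, y), g)] such that [x g = y] and [(x, g)] is in
    [F]. *)
Lemma shear_closed (F : set (X * G)) :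
  closed F -> closed ((fun p : X * G => (p.1, sigma p.1 p.2)) @` F).
Proof.
move=> cF.
pose C := [set q : (X * X) * G | sigma q.1.1 q.2 = q.1.2] `&`
          (fun q : (X * X) * G => (q.1.1, q.2)) @^-1` F.
have c11 : continuous (fun q : (X * X) * G => (q.1.1, q.2)).
  move=> q; apply: cvg_pair; last exact: cvg_snd.
  by apply: (@continuous_comp _ _ _ fst fst); exact: cvg_fst.
have -> : (fun p : X * G => (p.1, sigma p.1 p.2)) @` F = fst @` C.
  apply/seteqP; split=> [_ [[x g] Fxg <-]|_ [[[x y] g] [/= xgy Fxg] <-]].
    by exists ((x, sigma x g), g).
  by exists (x, g); rewrite //= xgy.
apply: closed_proj_compact => //; apply: closedI; last first.
  by apply: preimage_closed => // q _; exact: c11.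
apply: closed_coincidence => // q.
  apply: (@continuous_comp _ _ _ (fun q : (X * X) * G => (q.1.1, q.2))
    (fun p : X * G => sigma p.1 p.2)); first exact: c11.
  exact: csigma.
by apply: (@continuous_comp _ _ _ fst snd); [exact: cvg_fst|exact: cvg_snd].
Qed.

(** The preimage of a compact [L] is closed, [L] being closed in the Hausdorff
    space [X * X], and lies in the product of the first projection of [L] with
    the compact group. *)
Lemma shear_proper : proper_map (fun p : X * G => (p.1, sigma p.1 p.2)).
Proof.
split; [exact: shear_continuous|exact: shear_closed|move=> L cL].
apply: (@subclosed_compact _ _ ((fst @` L) `*` [set: G])).
- apply: preimage_closed; first by move=> p _; exact: shear_continuous.
  exact: compact_closed (hausdorff_prod hX hX) cL.
- apply: compact_setX => //; apply: continuous_compact => //.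
  by apply: continuous_subspaceT => p; exact: cvg_fst.
- by move=> p Lp; split => //; exists (p.1, sigma p.1 p.2).
Qed.

(** The inverse of the orbit map has the closed graph
    [{(y, g) | x g = y}] in a product with the compact group. *)
Lemma orbit_homeomorphic x :
  injective (sigma x) -> homeomorphic (orbit_set sigma x) G.
Proof.
move=> injx.
have /choice[f fE] (y : orbit_set sigma x) : exists g, sigma x g = val y.
  by have [g _ gy] := set_mem (valP y); exists g.
have orbg g : sigma x g \in orbit_set sigma x by apply/mem_set; exists g.
exists f, (fun g => exist (fun y => y \in orbit_set sigma x) _ (orbg g)).
split.
- by move=> y; apply: val_inj; rewrite /= fE.
- by move=> g; apply: injx; rewrite fE.
- apply: closed_graph_continuous => //.
  rewrite [X in closed X](_ : _ = [set p : orbit_set sigma x * G |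
      sigma x p.2 = val p.1]); last first.
    by apply/seteqP; split=> -[y g] /= => [<-|]; rewrite -?fE // => /injx.
  apply: closed_coincidence => // p.
    apply: (@continuous_comp _ _ _ snd); first exact: cvg_snd.
    exact: orbit_map_continuous.
  apply: (@continuous_comp _ _ _ fst); first exact: cvg_fst.
  exact: initial_continuous.
- apply: continuous_comp_initial; exact: orbit_map_continuous.
Qed.

(** The saturation of [U] is the union of its translates. *)
Lemma orbit_proj_open (U : set X) :
  open U -> open ((\pi_(orbit_space sigma) @` U)%qT : set (orbit_space sigma)).
Proof.
move=> oU; rewrite /open /= /quotient_open.
rewrite [X in open X](_ : _ = \bigcup_g (sigma^~ g @^-1` U)).
  apply: bigcup_open => g _; apply: open_comp => // x _.
  exact: ract_continuous.
apply/seteqP; split=> x /=.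
  case=> y Uy /eqquotP /asboolP[g _ ygx]; exists (g^-1)%g => //=.
  by rewrite -ygx ractKV.
case=> g _ Uxg; exists (sigma x g) => //; apply/eqquotP/asboolP.
by exists (g^-1)%g => //; exact: ractKV.
Qed.

(** Points of [X/G] that cannot be separated have representatives [x], [y]
    with [(x, y)] in the closure of the orbit relation: the projection, being
    open, turns neighbourhoods of [x] and [y] into neighbourhoods of their
    orbits.  The relation is closed, being the range of a closed map. *)
Lemma orbit_space_hausdorff : hausdorff_space (orbit_space sigma).
Proof.
move=> p q; rewrite -[p]reprK -[q]reprK.
move: (repr p) (repr q) => x y clxy; apply/eqquotP/asboolP.
have cR := shear_closed closedT.
suff : closure ((fun p : X * G => (p.1, sigma p.1 p.2)) @` setT) (x, y).
  by rewrite -(closure_id _).1 // => -[[z g] _ /= [-> <-]]; exists g.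
move=> W [[U V] /= [xU yV]] UVW.
have proj_nbhs z B : nbhs z B ->
    nbhs (\pi_(orbit_space sigma) z)%qT (\pi_(orbit_space sigma) @` B)%qT.
  rewrite nbhsE => -[O [oO Oz] OB]; apply: filterS (image_subset _ OB) _.
  by apply: open_nbhs_nbhs; split; [exact: orbit_proj_open|exists z].
have [_ [[a Ua <-] [b Vb]]] := clxy _ _ (proj_nbhs _ _ xU) (proj_nbhs _ _ yV).
move=> /esym/eqquotP /asboolP[g _ agb]; exists (a, b); split.
  by exists (a, g); rewrite //= agb.
exact: UVW.
Qed.

Theorem compact_free_action_bundle :
  (forall x g, sigma x g = x -> g = 1%g) -> topological_principal_bundle sigma.
Proof.
move=> free; split => //.
- exact: shear_proper.
- move=> x; apply: orbit_homeomorphic => g h xgh.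
  have : sigma x (g * h^-1)%g = x by rewrite ractM xgh ractKV.
  by move=> /free gh1; rewrite -[h]mul1g -gh1 mulgVK.
- exact: orbit_space_hausdorff.
Qed.

End CompactGroupAction.

(** * Characters of a continuous inverse algebra *)

Section Characters.
Context {K : numFieldType}.

Lemma spectrum_hausdorff (A : lcAlgType K) : hausdorff_space (spectrum A).
Proof.
apply: (@injective_hausdorff _ _ (set_val : spectrum A -> {ptws A -> K^o})).
- exact: initial_continuous.
- exact: val_inj.
- by apply: hausdorff_product => a; exact: norm_hausdorff.
Qed.

Section Algebra.
Context {A : lcAlgType K}.
Implicit Types (chi : spectrum A) (a b u : A) (c : K).

Lemma character_linear chi : linear (val chi : A -> K^o).
Proof. by have [] := set_mem (valP chi). Qed.

Lemma characterM chi a b : val chi (a * b) = val chi a * val chi b.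
Proof. by have [_ chiM _] := set_mem (valP chi); exact: chiM. Qed.

Lemma characterB chi a b : val chi (a - b) = val chi a - val chi b.
Proof.
by rewrite addrC -scaleN1r (character_linear chi) scaleN1r addrC.
Qed.

Lemma characterZ chi c a : val chi (c *: a) = c * val chi a.
Proof.
have chi0 : val chi 0 = 0 by rewrite -(subrr a) characterB subrr.
by rewrite -[c *: a]addr0 (character_linear chi) chi0 addr0.
Qed.

Lemma character1 chi : val chi 1 = 1.
Proof.
have [_ _ [a /eqP chia]] := set_mem (valP chi).
by apply: (mulfI chia); rewrite -characterM !mulr1.
Qed.

End Algebra.

Lemma character_unit_neq0 (A : ciaType K) (chi : spectrum A) (a : A) :
  a \is a GRing.unit -> val chi a != 0.
Proof.
move=> Ua; apply: contra_eq_neq (character1 chi) => chia0.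
by rewrite -(mulVr Ua) characterM chia0 mulr0 eq_sym oner_eq0.
Qed.

(** For [c] in a disc of radius [e] and [u] near [0] the element [1 - c u] is a
    unit.  If [|chi u|] exceeded [1/e], the scalar [c = 1 / chi u] would be
    allowed, and [chi] would kill that unit.  The bound does not depend on
    [chi]. *)
Lemma spectrum_bounded_near0 (A : ciaType K) :
  exists2 M : K, 0 < M &
    \forall u \near (0 : A), forall chi : spectrum A, `|val chi u| <= M.
Proof.
have unitB : \forall u \near (0 : A), 1 - u \is a GRing.unit.
  have c : continuous (fun u : A => 1 - u).
    move=> u; apply: (@continuous_comp _ _ _ (fun u : A => (1, - u))
      (fun p : A * A => p.1 + p.2)); last exact: add_continuous.
    by apply: cvg_pair; [exact: cvg_cst|exact: opp_continuous].
  suff Unbhs : nbhs (1 - 0 : A) [set a | a \is a GRing.unit] by exact: c Unbhs.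
  apply: open_nbhs_nbhs; split; first exact: unit_open.
  by rewrite /= subr0 unitr1.
have : nbhs ((0 : K^o), (0 : A)) [set z | 1 - z.1 *: z.2 \is a GRing.unit].
  suff Unbhs : nbhs ((0 : K^o) *: (0 : A)) [set u | 1 - u \is a GRing.unit].
    exact: (@scale_continuous K A (0, 0) _ Unbhs).
  by rewrite scale0r.
case=> -[C U] /= [/nbhs_ballP[e /= e0 eC] U0] CUunit.
exists e^-1; first by rewrite invr_gt0.
apply: filterS U0 => u Uu chi.
rewrite real_leNgt ?normr_real ?gtr0_real ?invr_gt0 //.
apply/negP => echi.
have chi0 : val chi u != 0.
  by rewrite -normr_gt0 (lt_trans _ echi) // invr_gt0.
have : 1 - (val chi u)^-1 *: u \is a GRing.unit.
  apply: (CUunit (_, _)); split => //; apply: eC.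
  rewrite -ball_normE /= sub0r normrN normfV.
  by rewrite -[e]invrK ltf_pV2 ?posrE ?invr_gt0 ?normr_gt0.
move=> /(character_unit_neq0 chi).
by rewrite characterB characterZ character1 mulVf // subrr eqxx.
Qed.

(** Linearity turns a uniform bound on a neighbourhood of [0] into
    equicontinuity, by rescaling the neighbourhood. *)
Lemma spectrum_equicontinuous_near0 (A : ciaType K) (e : K) : 0 < e ->
  \forall u \near (0 : A), forall chi : spectrum A, `|val chi u| < e.
Proof.
move=> e0; have [M M0 bound] := spectrum_bounded_near0 A.
(* The factor 2 turns the weak bound by M into a strict one. *)
pose c := 2 * M / e.
have c0 : 0 < c by rewrite divr_gt0 // mulr_gt0.
have cscale : continuous (fun u : A => c *: u).
  move=> u; apply: (@continuous_comp A (K^o * A)%type A (fun u => (c, u))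
      (fun z => z.1 *: z.2)); last exact: scale_continuous.
  have cstc : (c : K^o) @[_ --> u] --> (c : K^o) by exact: cvg_cst.
  exact: (cvg_pair cstc cvg_id).
rewrite -(scaler0 A c) in bound; 
have : \forall u \near (0 : A), forall chi : spectrum A,
    `|val chi (c *: u)| <= M.
  exact: cscale bound.
apply: filterS => u /= /[swap] chi /(_ chi).
rewrite characterZ normrM gtr0_norm // => cchi.
rewrite -(ltr_pM2l c0); apply: le_lt_trans cchi _.
by rewrite /c divfK ?gt_eqF // ltr_pMl // ltr1n.
Qed.

Lemma evaluation_continuous (A : lcAlgType K) (a : A) :
  continuous (fun chi : spectrum A => val chi a : K^o).
Proof.
move=> chi; apply: (@continuous_comp _ _ _
  (set_val : spectrum A -> {ptws A -> K^o}) (fun f => f a)).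
  exact: initial_continuous.
exact: proj_continuous.
Qed.

(** * The action on the spectrum *)

Section Action.
Context {A : ciaType K} {G : topologicalGroupType}.
Variable alpha : dynamical_system A G.

Lemma ds_orbit_continuous a : continuous (fun g => alpha g a).
Proof.
move=> g; apply: (@continuous_comp _ (G * A)%type _ (fun h => (h, a))
  (fun p => alpha p.1 p.2)); last exact: ds_continuous.
by apply: cvg_pair; [exact: cvg_id|exact: cvg_cst].
Qed.

(** Pointwise convergence controls a nearby character [psi] only at the fixed
    element [alpha g a]; on the error [alpha g a - alpha h a], where [psi] and
    [h] vary together, the equicontinuity of the spectrum takes over. *)
Lemma spectrum_action_continuous :
  continuous (fun p : spectrum A * G => spectrum_action alpha p.1 p.2).
Proof.
apply: continuous_comp_initial => -[chi g].
apply/pointwise_cvgP => a.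
apply/cvgrPdist_lt => e e0.
have e20 : 0 < e / 2 by rewrite divr_gt0.
have near_chi : \forall p \near (chi, g),
    `|val chi (alpha g a) - val p.1 (alpha g a)| < e / 2.
  have /cvgrPdist_lt ev : (val psi (alpha g a) : K^o) @[psi --> chi] -->
      (val chi (alpha g a) : K^o) by exact: evaluation_continuous.
  exact: (cvg_fst (ev _ e20)).
have near_g : \forall p \near (chi, g),
    forall psi : spectrum A, `|val psi (alpha g a - alpha p.2 a)| < e / 2.
  have small := spectrum_equicontinuous_near0 A e20.
  have cdiff : continuous (fun h => alpha g a - alpha h a).
    move=> h; apply: (@continuous_comp _ (A * A)%type A
      (fun h => (alpha g a, - alpha h a)) (fun z => z.1 + z.2)); last first.
      exact: add_continuous.
    apply: cvg_pair; first exact: cvg_cst.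
    apply: (@continuous_comp _ _ _ (fun h => alpha h a) -%R).
      exact: ds_orbit_continuous.
    exact: opp_continuous.
  rewrite -(subrr (alpha g a)) in small.
  have small_g : \forall h \near g, forall psi : spectrum A,
      `|val psi (alpha g a - alpha h a)| < e / 2 by exact: cdiff small.
  exact: (@cvg_snd _ _ (nbhs chi) (nbhs g) _ _ small_g).
near_simpl; near=> p => /=.
have -> :
    val (spectrum_act alpha chi g) a - val (spectrum_act alpha p.1 p.2) a =
    (val chi (alpha g a) - val p.1 (alpha g a)) +
    val p.1 (alpha g a - alpha p.2 a).
  by rewrite characterB addrA subrK.
rewrite [e]splitr; apply: le_lt_trans (ler_normD _ _) _; apply: ltrD.
  exact: (near near_chi p).
exact: (near near_g p).
Unshelve. all: by end_near. Qed.

End Action.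

(** Apply [chi (x) id] to [s = (alpha g (x) pi g) s] and pull [pi g] out. *)
Lemma tens_eval_invariant (A : lcAlgType K) (G : topologicalGroupType)
    (alpha : dynamical_system A G) (V : topologicalLmodType K)
    (pi : representation G V) (chi : spectrum A) (g : G) (s : tensor A V) :
  invariant_tensors alpha pi s ->
  tens_eval chi s = pi g (tens_eval (spectrum_act alpha chi g) s).
Proof.
move=> /(_ g) {1}<-.
have -> : tens_map (alpha g) (pi g) s =
    tens_pi [seq (alpha g p.1, pi g p.2) | p <- repr s].
  by rewrite tens_piE big_map.
rewrite /tens_eval tens_lift_pi => [|v c a b|a c v w]; first last.
- by rewrite scalerDr !scalerA mulrC.
- by rewrite (character_linear chi) scalerDl scalerA.
rewrite big_map linear_sum; apply: eq_bigr => p _.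
by rewrite linearZ.
Qed.

Lemma free_system_free_action (A : lcAlgType K) (G : topologicalGroupType)
    (alpha : dynamical_system A G) (chi : spectrum A) (g : G) :
  free_system alpha -> spectrum_action alpha chi g = chi -> g = 1%g.
Proof.
move=> [J [V [pi [sep surj]]]] chig; apply: contrapT => /sep[j]; apply=> v.
have [s invs <-] := surj j chi v I.
by rewrite [RHS](tens_eval_invariant chi g invs) [spectrum_act _ _ _]chig.
Qed.

End Characters.

Theorem theorem7p7 (R : realType) (A : comCiaType R[i])
    (G : topologicalGroupType) (alpha : dynamical_system A G) :
  compact [set: G] ->
  free_system alpha ->
  continuous (fun p : spectrum A * G => spectrum_action alpha p.1 p.2) /\
  topological_principal_bundle (spectrum_action alpha).
Proof.
move=> cG free; have cont := @spectrum_action_continuous _ _ _ alpha.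
split=> //; apply: compact_free_action_bundle => //.
- exact: spectrum_hausdorff.
- by move=> chi g; exact: free_system_free_action.
Qed.
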